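(* For the simple eigenvalue $\lambda_*$ of $T$, let $\widehat\sigma_1\leq\widehat\sigma_2\leq\cdots\leq\widehat\sigma_m$ be the singular values of $T(\mu)W$, with $m$ being the number of columns of $W$, and let $|\mu-\lambda_*|$ be sufficiently small such that $$\widehat\sigma_1<\frac12\sigma_2(T(\lambda_* ))-\|T'(\lambda_* )\||\mu-\lambda_*|\quad\text{and}\quad\sigma_2(T(\lambda_* ))>2\gamma|\mu-\lambda_*|^2.$$ Then $\widehat\sigma_1$ is simple, and the refined Ritz vector $\widehat x$ corresponding to $\mu$ is unique.
   Context: $\Omega\subseteq\mathbb{C}$ is a connected open set and $T:\Omega\to\mathbb{C}^{n\times n}$ is an analytic matrix-valued function that is regular, i.e. $\det T(\lambda)$ is not identically zero on $\Omega$. $\lambda_*\in\Omega$ is a simple eigenvalue of $T$, i.e. a simple root of $\det T(\lambda)=0$. $\|\cdot\|$ is the 2-norm and $H$ denotes conjugate transpose. $\sigma_2(T(\lambda_* ))$ is the second smallest singular value of $T(\lambda_* )$ (counted with multiplicity; the smallest is $\sigma_1=\sigma_{\min}=0$). $\mathcal{W}\subset\mathbb{C}^n$ is an $m$-dimensional subspace and $W\in\mathbb{C}^{n\times m}$ has orthonormal columns spanning $\mathcal{W}$. The Ritz value $\mu\in\Omega$ is an eigenvalue of $B(\lambda)=W^HT(\lambda)W$ ($\det B(\mu)=0$) selected to approximate $\lambda_*$. The refined Ritz vector $\widehat x\in\mathcal{W}$ is a unit-length vector satisfying $\|T(\mu)\widehat x\|=\min_{v\in\mathcal{W},\|v\|=1}\|T(\mu)v\|$;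 equivalently $\widehat x=Wy$ with $y$ a unit right singular vector of $T(\mu)W$ associated with its smallest singular value. Uniqueness is understood up to a scalar factor of modulus one. It is assumed that $\mu$ lies in a closed disc $\mathcal{D}=\{\mu\in\Omega:|\mu-\lambda_*|\leq r\}\subset\Omega$. Here $\eta$ is an arbitrarily given (positive) constant and $r$ is sufficiently small that, in the Taylor expansion $T(\mu)=T(\lambda_* )+T'(\lambda_* )(\mu-\lambda_* )+\bigl(\frac{T''(\lambda_* )}{2}+O(\mu-\lambda_* )\bigr)(\mu-\lambda_* )^2$, the $O(\mu-\lambda_* )$ term has norm at most $\eta$ for all $\mu\in\mathcal{D}$; then $\gamma:=\frac{\|T''(\lambda_* )\|}{2}+\eta$. *)

(* Defs.v *)
From HB Require Import structures.
From mathcomp Require Import all_boot all_order all_algebra.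
From mathcomp Require Import complex.
From mathcomp Require Import all_classical all_reals all_analysis.

Set Implicit Arguments.
Unset Strict Implicit.
Unset Printing Implicit Defensive.

Import Order.TTheory GRing.Theory Num.Theory.
Import numFieldNormedType.Exports.

Local Open Scope classical_set_scope.
Local Open Scope ring_scope.
Local Open Scope complex_scope.
Local Open Scope sesquilinear_scope.

(* R[i] does not by itself carry the topology and the normed-module structure
   of MathComp-Analysis; they are inferred once it is presented as an element
   of [numClosedFieldType]. *)
Definition Cplx (R : realType) : numClosedFieldType := R[i].

(* The modulus of a complex number, as an element of R; the norm [`|z|] of
   [Cplx R] is the same number seen in [Cplx R]. *)
Definition modulus (R : realType) (z : Cplx R) : R := Normc.normc z.

Definition closed_disc (R : realType) (c : Cplx R) (r : R) : set (Cplx R) :=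
  [set z | modulus (z - c) <= r].

(* Every point of U has a neighbourhood on which f is the sum of a power series
   centred at that point. For matrix-valued f the convergence is entrywise. *)
Definition analytic_on (C : numFieldType) (V : normedModType C)
    (U : set C) (f : C -> V) : Prop :=
  forall z0, U z0 -> exists a : nat -> V,
    \forall z \near z0, series (fun k => (z - z0) ^+ k *: a k) @ \oo --> f z.

Section MatrixNorms.
Context {R : realType}.
Local Notation C := (Cplx R).

Definition norm2 n (v : 'cV[C]_n) : R :=
  Num.sqrt (\sum_i modulus (v i 0) ^+ 2).

Definition mxnorm2 m n (A : 'M[C]_(m, n)) : R :=
  sup [set norm2 (A *m v) | v in [set v : 'cV[C]_n | norm2 v = 1]].

(* The n singular values of A in increasing order, with multiplicity: square
   roots of the eigenvalues of A^H A, which [spectral_diag] lists, the Gram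
   matrix being normal. For m < n this includes n - m extra zeros. *)
Definition singular_values m n (A : 'M[C]_(m, n)) : seq R :=
  sort <=%R
    [seq Num.sqrt (complex.Re (spectral_diag (A^t* *m A) 0 j)) | j : 'I_n].

(* Indices start at 1. *)
Definition sigma (k : nat) m n (A : 'M[C]_(m, n)) : R :=
  nth 0 (singular_values A) k.-1.

End MatrixNorms.

Section NonlinearEigenproblem.
Context {R : realType}.
Local Notation C := (Cplx R).

Definition regular_on n (Omega : set C) (F : C -> 'M[C]_n) : Prop :=
  exists2 z, Omega z & \det (F z) != 0.

Definition eigenvalue_in n (Omega : set C) (F : C -> 'M[C]_n) (l : C) : Prop :=
  Omega l /\ \det (F l) = 0.

Definition simple_eigenvalue_in n (Omega : set C) (F : C -> 'M[C]_n) (l : C) :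
    Prop :=
  eigenvalue_in Omega F l /\ derive1 (fun z => \det (F z)) l != 0.

(* The remainder E in
     F z = F l + F'(l) (z - l) + (F''(l) / 2 + E z) (z - l)^2,
   with E l = 0. *)
Definition taylor2_remainder n (F : C -> 'M[C]_n) (l z : C) : 'M[C]_n :=
  ((z - l) ^+ 2)^-1 *:
    (F z - (F l + (z - l) *: derive1 F l
            + (z - l) ^+ 2 *: (2^-1 *: derive1n 2 F l))).

Definition orthonormal_basis_mx n m (WW : {vspace 'cV[C]_n})
    (W : 'M[C]_(n, m)) : Prop :=
  W^t* *m W = 1%:M /\ <<[seq col j W | j : 'I_m]>>%VS = WW.

Definition projected n m (W : 'M[C]_(n, m)) (F : C -> 'M[C]_n) : C -> 'M[C]_m :=
  fun z => W^t* *m F z *m W.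

Definition refined_ritz_vector n (WW : {vspace 'cV[C]_n}) (F : C -> 'M[C]_n)
    (mu : C) (x : 'cV[C]_n) : Prop :=
  [/\ x \in WW, norm2 x = 1 &
      forall v, v \in WW -> norm2 v = 1 -> norm2 (F mu *m x) <= norm2 (F mu *m v)].

End NonlinearEigenproblem.

(* Main.v *)
(* The Taylor expansion bounds T(lambda) - T(mu) by
   delta = ||T'(lambda)|| |mu - lambda| + gamma |mu - lambda|^2, and the two
   hypotheses give sigma_1(T(mu) W) + delta < sigma_2(T(lambda)). Were the least
   singular value of T(mu) W multiple, some unit x in the range of W would satisfy
   both ||T(mu) x|| = sigma_1(T(mu) W) and ||T(lambda) x|| >= sigma_2(T(lambda)),
   contradicting this inequality. Once it is simple, expanding in an eigenbasis of
   the Gram matrix of T(mu) W shows that the minimizer is unique up to a phase. *)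
Require Import Defs.
From HB Require Import structures.
From mathcomp Require Import all_boot all_order all_algebra.
From mathcomp Require Import complex.
From mathcomp Require Import all_classical all_reals all_analysis.
From mathcomp Require Import ring lra.
Import Order.TTheory GRing.Theory Num.Theory.
Import numFieldNormedType.Exports.
Local Open Scope classical_set_scope.
Local Open Scope ring_scope.

Section SingularValues.
Set Implicit Arguments.
Unset Strict Implicit.
Unset Printing Implicit Defensive.
Context {R : realType}.
Local Notation C := (Cplx R).
Local Open Scope complex_scope.
Local Open Scope sesquilinear_scope.

(** * Modulus and Euclidean norm *)

Lemma modulus_ge0 (z : C) : 0 <= modulus z.
Proof. by rewrite -lecR; exact: (normr_ge0 z). Qed.

Lemma modulusM (x y : C) : modulus (x * y) = modulus x * modulus y.
Proof. exact: Normc.normcM. Qed.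

Lemma modulus0 : modulus (0 : C) = 0.
Proof. exact: Normc.normc0. Qed.

Lemma modulus1 : modulus (1 : C) = 1.
Proof. exact: Normc.normc1. Qed.

Lemma modulus_eq0 (z : C) : modulus z = 0 -> z = 0.
Proof. exact: Normc.eq0_normc. Qed.

Lemma norm2_ge0 n (v : 'cV[C]_n) : 0 <= norm2 v.
Proof. exact: sqrtr_ge0. Qed.

Lemma norm2_sqr n (v : 'cV[C]_n) :
  norm2 v ^+ 2 = \sum_i modulus (v i 0) ^+ 2.
Proof. by rewrite sqr_sqrtr // sumr_ge0 // => i _; rewrite sqr_ge0. Qed.

(** Lets matrix identities for Gram matrices be read as identities between norms. *)
Lemma norm2_gram n (v : 'cV[C]_n) :
  (v^t* *m v) 0 0 = ((norm2 v ^+ 2)%:C : C).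
Proof.
rewrite norm2_sqr mxE rmorph_sum; apply: eq_bigr => i _.
by rewrite !mxE mulrC -normCK rmorphXn.
Qed.

Lemma norm2_isometry n m (W : 'M[C]_(n, m)) (v : 'cV[C]_m) :
  W^t* *m W = 1%:M -> norm2 (W *m v) = norm2 v.
Proof.
move=> W1; apply/eqP; rewrite -(@eqrXn2 _ 2) ?norm2_ge0//; apply/eqP.
apply: (@complexI R); rewrite -!norm2_gram.
by rewrite trmx_mul map_mxM mulmxA -(mulmxA _ _ W) W1 mulmx1.
Qed.

Lemma norm2_eq0 n (v : 'cV[C]_n) : norm2 v = 0 -> v = 0.
Proof.
move=> v0; apply/colP => i; rewrite mxE; apply: modulus_eq0.
have /eqP := norm2_sqr v; rewrite v0 expr0n eq_sym/= psumr_eq0 => [|j _].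
  by move=> /allP/(_ i (mem_index_enum _)); rewrite sqrf_eq0 => /eqP.
exact: sqr_ge0.
Qed.

Lemma norm2Z n (a : C) (v : 'cV[C]_n) : norm2 (a *: v) = modulus a * norm2 v.
Proof.
apply/eqP; rewrite -(@eqrXn2 _ 2) ?mulr_ge0 ?norm2_ge0 ?modulus_ge0//.
rewrite exprMn !norm2_sqr mulr_sumr; apply/eqP/eq_bigr => i _.
by rewrite mxE modulusM exprMn.
Qed.

Lemma norm20 n : norm2 (0 : 'cV[C]_n) = 0.
Proof. by rewrite -(scale0r 0) norm2Z modulus0 mul0r. Qed.

Lemma norm2_triangle n (u v : 'cV[C]_n) : norm2 (u + v) <= norm2 u + norm2 v.
Proof.
have [u0|u0] := eqVneq (norm2 u) 0.
  by rewrite u0 (norm2_eq0 u0) !add0r.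
have [v0|v0] := eqVneq (norm2 v) 0.
  by rewrite v0 (norm2_eq0 v0) !addr0.
have {u0} a0 : 0 < norm2 u by rewrite lt_def u0 norm2_ge0.
have {v0} b0 : 0 < norm2 v by rewrite lt_def v0 norm2_ge0.
rewrite -(@ler_pXn2r _ 2) ?nnegrE ?addr_ge0 ?norm2_ge0//.
set a := norm2 u in a0 *; set b := norm2 v in b0 *.
(* Weighted AM-GM: (x + y)^2 <= (1 + b/a) x^2 + (1 + a/b) y^2, with equality for
   x = a, y = b. *)
have -> : (a + b) ^+ 2 = (1 + b / a) * a ^+ 2 + (1 + a / b) * b ^+ 2.
  by field; rewrite !gt_eqF.
rewrite !norm2_sqr !mulr_sumr -big_split; apply: ler_sum => i _ /=.
rewrite mxE.
set x := modulus (u i 0); set y := modulus (v i 0).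
have xy : modulus (u i 0 + v i 0) <= x + y by exact: le_normcD.
apply: (@le_trans _ _ ((x + y) ^+ 2)).
  by rewrite ler_pXn2r ?nnegrE ?addr_ge0 ?modulus_ge0.
rewrite -subr_ge0.
have -> : (1 + b / a) * x ^+ 2 + (1 + a / b) * y ^+ 2 - (x + y) ^+ 2 =
    (b * x - a * y) ^+ 2 / (a * b) by field; rewrite !gt_eqF.
by rewrite divr_ge0 ?sqr_ge0// mulr_ge0// ltW.
Qed.

(** * Spectral decomposition of the Gram matrix *)

(* The same singular values as [singular_values A], but indexed like the vectors
   of [gram_basis A]. *)
Definition gram_sv m n (A : 'M[C]_(m, n)) (j : 'I_n) : R :=
  Num.sqrt (complex.Re (spectral_diag (A^t* *m A) 0 j)).

(** The eigenvectors are the columns of the conjugate transpose, so [gram_basis A *m v] holds the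
    coordinates of [v] in the eigenbasis. *)
Definition gram_basis m n (A : 'M[C]_(m, n)) : 'M[C]_n :=
  spectralmx (A^t* *m A).

Lemma gram_basisK m n (A : 'M[C]_(m, n)) :
  (gram_basis A)^t* *m gram_basis A = 1%:M.
Proof.
rewrite -invmx_unitary ?spectral_unitarymx// mulVmx//.
exact: spectral_unit.
Qed.

Lemma gram_basisVK m n (A : 'M[C]_(m, n)) :
  gram_basis A *m (gram_basis A)^t* = 1%:M.
Proof. exact/unitarymxP/spectral_unitarymx. Qed.

Lemma gram_spectral m n (A : 'M[C]_(m, n)) :
  A^t* *m A =
  (gram_basis A)^t* *m diag_mx (spectral_diag (A^t* *m A)) *m gram_basis A.
Proof.
rewrite -invmx_unitary ?spectral_unitarymx//; apply/orthomx_spectralP.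
by apply/normalmxP; rewrite trmx_mul map_mxM trmxCK.
Qed.

Lemma norm2_mulmx_gram m n (A : 'M[C]_(m, n)) (v : 'cV[C]_n) :
  (norm2 (A *m v) ^+ 2)%:C =
  \sum_j spectral_diag (A^t* *m A) 0 j * `|(gram_basis A *m v) j 0| ^+ 2 :> C.
Proof.
have -> : ((norm2 (A *m v) ^+ 2)%:C : C) =
    ((gram_basis A *m v)^t* *m diag_mx (spectral_diag (A^t* *m A)) *m
     (gram_basis A *m v)) 0 0.
  rewrite -norm2_gram trmx_mul map_mxM mulmxA -(mulmxA _ _ A) {1}gram_spectral.
  by rewrite (trmx_mul (gram_basis A)) map_mxM !mulmxA.
move: (gram_basis A *m v) => z; rewrite mul_mx_diag mxE; apply: eq_bigr => j _.
by rewrite !mxE normCKC mulrAC mulrC.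
Qed.

(** On a unit eigenvector [w] the eigenvalue equals the square of [norm2 (A *m w)]. It is thus real
    and nonnegative, and taking the real part and the square root in [gram_sv] loses nothing. *)
Lemma spectral_diag_gram m n (A : 'M[C]_(m, n)) (j : 'I_n) :
  spectral_diag (A^t* *m A) 0 j = (gram_sv A j ^+ 2)%:C.
Proof.
pose w : 'cV[C]_n := (gram_basis A)^t* *m delta_mx j 0.
have := norm2_mulmx_gram A w.
rewrite [gram_basis A *m w]mulmxA gram_basisVK mul1mx (bigD1 j)//= big1 => [|i ij].
  rewrite mxE !eqxx normr1 expr1n mulr1 addr0 /gram_sv => <-.
  move: (sqr_ge0 (norm2 (A *m w))); move: (norm2 _ ^+ 2) => x x0.
  by rewrite sqr_sqrtr.
by rewrite mxE (negbTE ij) normr0 expr0n mulr0.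
Qed.

Lemma norm2_mulmx_sqr m n (A : 'M[C]_(m, n)) (v : 'cV[C]_n) :
  norm2 (A *m v) ^+ 2 =
  \sum_j gram_sv A j ^+ 2 * modulus ((gram_basis A *m v) j 0) ^+ 2.
Proof.
apply: (@complexI R); rewrite norm2_mulmx_gram rmorph_sum/=.
apply: eq_bigr => j _; rewrite spectral_diag_gram [RHS]rmorphM.
by congr (_ * _); rewrite [RHS]rmorphXn.
Qed.

Lemma norm2_gram_basis m n (A : 'M[C]_(m, n)) (v : 'cV[C]_n) :
  norm2 (gram_basis A *m v) = norm2 v.
Proof. exact/norm2_isometry/gram_basisK. Qed.

Lemma norm2_gram_basisV m n (A : 'M[C]_(m, n)) (v : 'cV[C]_n) :
  norm2 ((gram_basis A)^t* *m v) = norm2 v.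
Proof.
apply: norm2_isometry; rewrite trmxCK; exact: gram_basisVK.
Qed.

Lemma gram_sv_ge0 m n (A : 'M[C]_(m, n)) (j : 'I_n) : 0 <= gram_sv A j.
Proof. exact: sqrtr_ge0. Qed.

(** Compares the eigenbasis expansions term by term. Restricting the hypothesis to nonzero
    coordinates makes the bound usable on spans of some of the eigenvectors. *)
Lemma norm2_mulmx_ge m n (A : 'M[C]_(m, n)) (v : 'cV[C]_n) (s : R) :
  (forall j, (gram_basis A *m v) j 0 != 0 -> s <= gram_sv A j) ->
  s * norm2 v <= norm2 (A *m v).
Proof.
move=> hs; have [s0|/ltW s0] := leP 0 s; last first.
  by apply: (le_trans _ (norm2_ge0 _)); rewrite mulr_le0_ge0 ?norm2_ge0.
rewrite -(@ler_pXn2r _ 2) ?nnegrE ?mulr_ge0 ?norm2_ge0//.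
rewrite norm2_mulmx_sqr exprMn -(norm2_gram_basis A) norm2_sqr mulr_sumr.
apply: ler_sum => j _; have [->|/hs sj] := eqVneq ((gram_basis A *m v) j 0) 0.
  by rewrite modulus0 expr0n !mulr0.
by rewrite ler_wpM2r ?sqr_ge0// ler_pXn2r ?nnegrE ?gram_sv_ge0.
Qed.

Lemma norm2_mulmx_le m n (A : 'M[C]_(m, n)) (v : 'cV[C]_n) (s : R) :
  0 <= s -> (forall j, (gram_basis A *m v) j 0 != 0 -> gram_sv A j <= s) ->
  norm2 (A *m v) <= s * norm2 v.
Proof.
move=> s0 hs; rewrite -(@ler_pXn2r _ 2) ?nnegrE ?mulr_ge0 ?norm2_ge0//.
rewrite norm2_mulmx_sqr exprMn -(norm2_gram_basis A) norm2_sqr mulr_sumr.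
apply: ler_sum => j _; have [->|/hs sj] := eqVneq ((gram_basis A *m v) j 0) 0.
  by rewrite modulus0 expr0n !mulr0.
by rewrite ler_wpM2r ?sqr_ge0// ler_pXn2r ?nnegrE ?gram_sv_ge0.
Qed.

(** * Ordered singular values and the operator norm *)

Lemma singular_values_sorted m n (A : 'M[C]_(m, n)) :
  sorted <=%R (singular_values A).
Proof. exact: sort_le_sorted. Qed.

Lemma count_singular_values m n (A : 'M[C]_(m, n)) (p : pred R) :
  count p (singular_values A) = #|[pred j | p (gram_sv A j)]|.
Proof.
rewrite (permP (permEl (perm_sort _ _))) count_map enumT.
by rewrite cardE /enum_mem size_filter.
Qed.

Lemma size_singular_values m n (A : 'M[C]_(m, n)) :
  size (singular_values A) = n.
Proof. by rewrite size_sort size_map size_enum_ord. Qed.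

Lemma sigma1_le m n (A : 'M[C]_(m, n)) (j : 'I_n) : sigma 1 A <= gram_sv A j.
Proof.
have : gram_sv A j \in singular_values A.
  by rewrite mem_sort; apply/mapP; exists j; rewrite ?mem_enum.
rewrite /sigma/=; have := singular_values_sorted A.
case: (singular_values A) => [//|a l] /= /(order_path_min le_trans)/allP al.
by rewrite in_cons => /orP[/eqP->|/al].
Qed.

Lemma sigma1_attained m n (A : 'M[C]_(m, n)) :
  (0 < n)%N -> exists j, gram_sv A j = sigma 1 A.
Proof.
move=> n0; have : sigma 1 A \in singular_values A.
  by rewrite mem_nth// size_singular_values.
by rewrite mem_sort => /mapP[j _ ->]; exists j.
Qed.

(** In the sorted list only the first entry can lie strictly below the second, so at most one index
    is exceptional. *)
Lemma sigma2_le m n (A : 'M[C]_(m, n)) :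
  (1 < n)%N -> exists j0, forall j, j != j0 -> sigma 2 A <= gram_sv A j.
Proof.
move=> n1; set s := sigma 2 A.
have card1 : (#|[pred j | (gram_sv A j < s)%R]| <= 1)%N.
  rewrite -(count_singular_values A (fun x => x < s)).
  have := singular_values_sorted A; have := size_singular_values A.
  rewrite /s /sigma/=; case: (singular_values A) => [|a [|b l]] /=;
    try by move=> nE; move: n1; rewrite -nE.
  move=> _ /andP[_ /(order_path_min le_trans)/allP bl].
  rewrite ltxx add0n (_ : count _ l = 0%N) ?addn0 ?leq_b1//.
  by apply/eqP; rewrite -leqn0 leqNgt -has_count; apply/hasPn => x /bl;
     rewrite -leNgt.
have [j0 j0s|none] := pickP [pred j | gram_sv A j < s].
  exists j0 => j /eqP jj0; rewrite leNgt; apply/negP => js.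
  by apply: jj0; apply: (card_le1_eqP card1).
(* No singular value lies below [s], so any index will do. *)
exists (Ordinal (ltnW n1)) => j _; rewrite leNgt; exact/negbT/none.
Qed.

Lemma norm2_mulmx_has_ubound m n (A : 'M[C]_(m, n)) :
  has_ubound [set norm2 (A *m v) | v in [set v : 'cV[C]_n | norm2 v = 1]].
Proof.
(* A crude bound suffices: each singular value is at most the sum of all. *)
exists (\sum_j gram_sv A j) => _ [v /= v1 <-]; rewrite -[leRHS]mulr1 -v1.
apply: norm2_mulmx_le => [|j _].
  by rewrite sumr_ge0// => j _; exact: gram_sv_ge0.
by rewrite (bigD1 j)//= lerDl sumr_ge0// => i _; exact: gram_sv_ge0.
Qed.

Lemma norm2_mulmx_mxnorm2 m n (A : 'M[C]_(m, n)) (v : 'cV[C]_n) :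
  norm2 (A *m v) <= mxnorm2 A * norm2 v.
Proof.
have [v0|v0] := eqVneq (norm2 v) 0.
  by rewrite (norm2_eq0 v0) mulmx0 !norm20 mulr0.
have vp : 0 < norm2 v by rewrite lt_def v0 norm2_ge0.
rewrite -ler_pdivrMr//.
have mc : modulus ((norm2 v)^-1%:C : C) = (norm2 v)^-1.
  by apply: (@complexI R); apply: ger0_norm; rewrite lecR invr_ge0 norm2_ge0.
apply: ub_le_sup; first exact: norm2_mulmx_has_ubound.
exists ((norm2 v)^-1%:C *: v) => /=; first by rewrite norm2Z mc mulVf.
by rewrite -scalemxAr norm2Z mc mulrC.
Qed.

Lemma sigma1_ge0 m n (A : 'M[C]_(m, n)) : 0 <= sigma 1 A.
Proof.
have [n0|n0] := posnP n; last first.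
  by have [j <-] := sigma1_attained A n0; exact: gram_sv_ge0.
(* Without columns, [sigma 1 A] is the default value 0. *)
by rewrite /sigma nth_default// size_singular_values n0.
Qed.

(** * Simplicity of the least singular value, and its minimizers *)

(** One homogeneous linear equation in two unknowns has a nonzero solution. The generic one could
    vanish when [Q i0 j1 = 0], but then the basis vector at [j1] is a solution. *)
Lemma row_kernel_two_columns p m (Q : 'M[C]_(p, m)) (i0 : 'I_p) (j1 j2 : 'I_m) :
  j1 != j2 -> exists z : 'cV[C]_m, [/\ z != 0,
    forall j, z j 0 != 0 -> j = j1 \/ j = j2 & (Q *m z) i0 0 = 0].
Proof.
move=> j12.
have Qe j : (Q *m delta_mx j (0 : 'I_1)) i0 0 = Q i0 j.
  by rewrite -colE mxE.
have [Q1|Q1] := eqVneq (Q i0 j1) 0.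
  exists (delta_mx j1 0); split; last by rewrite Qe.
    apply/eqP => /colP/(_ j1)/eqP; rewrite !mxE !eqxx/=; exact/negP/oner_neq0.
  move=> j; rewrite mxE; case: (eqVneq j j1) => [|_]; first by left.
  by rewrite /= eqxx.
exists (Q i0 j2 *: delta_mx j1 0 - Q i0 j1 *: delta_mx j2 0); split.
- apply/eqP => /colP/(_ j2)/eqP.
  by rewrite !mxE !eqxx [j2 == j1]eq_sym (negbTE j12)/= mulr0 mulr1 sub0r
    oppr_eq0 (negbTE Q1).
- move=> j; rewrite !mxE; case: (eqVneq j j1) => [|_]; first by left.
  case: (eqVneq j j2) => [|_]; first by right.
  by rewrite /= !mulr0 subrr eqxx.
- rewrite mulmxBr -!scalemxAr.
  have -> : (Q i0 j2 *: (Q *m delta_mx j1 0) - Q i0 j1 *: (Q *m delta_mx j2 0))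
      i0 (0 : 'I_1) = Q i0 j2 * (Q *m delta_mx j1 (0 : 'I_1)) i0 0
                      - Q i0 j1 * (Q *m delta_mx j2 (0 : 'I_1)) i0 0.
    by rewrite !mxE.
  by rewrite !Qe mulrC subrr.
Qed.

(* If the minimal singular value of [B *m W] occurred at two indices, B would be
   scaled by [sigma 1 (B *m W)] on a plane; that plane meets the hyperplane on
   which A expands by at least [sigma 2 A]. *)
Lemma sigma1_simple_perturbation p n m (A B : 'M[C]_(p, n))
    (W : 'M[C]_(n, m)) (delta : R) (j1 j2 : 'I_m) :
  (1 < n)%N -> W^t* *m W = 1%:M ->
  (forall x, norm2 ((A - B) *m x) <= delta * norm2 x) ->
  sigma 1 (B *m W) + delta < sigma 2 A ->
  gram_sv (B *m W) j1 = sigma 1 (B *m W) ->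
  gram_sv (B *m W) j2 = sigma 1 (B *m W) -> j1 = j2.
Proof.
move=> n1 W1 ABle gap sj1 sj2; apply/eqP/negPn/negP => j12.
have [j0 j0P] := sigma2_le A n1.
(* Row [j0] of [Q] sends the eigenbasis coordinates of [y] for [B *m W] to the coordinate of
   [W *m y] along the exceptional eigenvector of [A]; it vanishes for the [y] chosen below. *)
set P := gram_basis (B *m W); set Q := gram_basis A *m W *m P^t*.
have [z [z0 zj Qz]] := row_kernel_two_columns Q j0 j12.
pose y := P^t* *m z; pose x := W *m y.
have Py : P *m y = z by rewrite mulmxA gram_basisVK mul1mx.
have xz : norm2 x = norm2 z by rewrite norm2_isometry// norm2_gram_basisV.
have x0 : 0 < norm2 x.
  rewrite lt_def norm2_ge0 andbT xz; apply: contra z0 => /eqP/norm2_eq0 ->.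
  exact: eqxx.
have Bx : norm2 (B *m x) <= sigma 1 (B *m W) * norm2 x.
  rewrite mulmxA [norm2 x]norm2_isometry//; apply: norm2_mulmx_le.
    exact: sigma1_ge0.
  by move=> j; rewrite Py => /zj[] ->; rewrite ?sj1 ?sj2.
have Ax : sigma 2 A * norm2 x <= norm2 (A *m x).
  apply: norm2_mulmx_ge => j jx; apply: j0P; apply: contra jx => /eqP ->.
  by rewrite /x /y !mulmxA Qz.
have : norm2 (A *m x) <= norm2 (B *m x) + norm2 ((A - B) *m x).
  by rewrite (le_trans _ (norm2_triangle _ _))// mulmxBl addrC subrK.
(* Dividing by [norm2 x] gives [sigma 2 A <= sigma 1 (B *m W) + delta], against [gap]. *)
move=> /(le_trans Ax)/le_trans/(_ (lerD Bx (ABle x))).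
by rewrite -mulrDl ler_pM2r// leNgt gap.
Qed.

(** The squared singular values minus the least one, weighted by the squared moduli of the
    coordinates of [y], are nonnegative with sum at most 0. Each term vanishes, leaving only the
    coordinate [j0]. *)
Lemma norm2_mulmx_le_sigma1 m n (A : 'M[C]_(m, n)) (j0 : 'I_n) (y : 'cV[C]_n) :
  (forall j, gram_sv A j = sigma 1 A -> j = j0) ->
  norm2 (A *m y) <= sigma 1 A * norm2 y ->
  y = (gram_basis A *m y) j0 0 *: ((gram_basis A)^t* *m delta_mx j0 0).
Proof.
move=> j0P Ay; set z := gram_basis A *m y.
have zj j : j != j0 -> z j 0 = 0.
  move=> jj0; apply: modulus_eq0; apply/eqP; rewrite -sqrf_eq0.
  have term0 i : 0 <= (gram_sv A i ^+ 2 - sigma 1 A ^+ 2) * modulus (z i 0) ^+ 2.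
    rewrite mulr_ge0 ?sqr_ge0// subr_ge0.
    by rewrite ler_pXn2r ?nnegrE ?gram_sv_ge0 ?sigma1_ge0 ?sigma1_le.
  have sum0 : \sum_i (gram_sv A i ^+ 2 - sigma 1 A ^+ 2) * modulus (z i 0) ^+ 2 == 0.
    rewrite eq_le sumr_ge0 ?andbT//.
    under eq_bigr do rewrite mulrBl.
    rewrite big_split/= sumrN -mulr_sumr -norm2_mulmx_sqr -norm2_sqr.
    rewrite norm2_gram_basis -exprMn subr_le0.
    by rewrite ler_pXn2r ?nnegrE ?mulr_ge0 ?sigma1_ge0 ?norm2_ge0.
  move: sum0; rewrite psumr_eq0 => [/allP/(_ j (mem_index_enum _))/=|i _]; last first.
    exact: term0.
  rewrite mulf_eq0 => /orP[|//]; rewrite subr_eq0 eqrXn2 ?gram_sv_ge0 ?sigma1_ge0//.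
  by move=> /eqP/j0P/eqP; rewrite (negbTE jj0).
have zE : z = z j0 0 *: delta_mx j0 0.
  apply/colP => j; rewrite [RHS]mxE [delta_mx _ _ _ _]mxE.
  case: (eqVneq j j0) => [->|/zj ->]; first by rewrite /= mulr1.
  by rewrite /= mulr0.
by rewrite scalemxAr -zE /z mulmxA gram_basisK mul1mx.
Qed.

(** * Taylor perturbation and the Ritz subspace *)

(* The Taylor formula holds by definition of the remainder, except at z = l where
   [taylor2_remainder] divides by zero but has coefficient 0. *)
Lemma taylor2_perturbation n (T : C -> 'M[C]_n) (l z : C) (eta : R)
    (x : 'cV[C]_n) :
  mxnorm2 (taylor2_remainder T l z) <= eta ->
  norm2 ((T l - T z) *m x) <=
  (mxnorm2 (derive1 T l) * modulus (z - l)
   + (mxnorm2 (derive1n 2 T l) / 2 + eta) * modulus (z - l) ^+ 2) * norm2 x.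
Proof.
set T1 := derive1 T l; set T2 := derive1n 2 T l.
set E := taylor2_remainder T l z.
move=> Eeta; set h := z - l.
have TE : T z - T l = h *: T1 + h ^+ 2 *: (2^-1 *: T2 + E).
  have [h0|h0] := eqVneq h 0.
    have -> : z = l by apply/eqP; rewrite -subr_eq0 -/h h0.
    by rewrite h0 expr0n/= !scale0r addr0 subrr.
  rewrite scalerDr /E /taylor2_remainder -/h.
  rewrite [X in _ + (_ + X)]scalerA divff ?expf_neq0//.
  rewrite scale1r -/T1 -/T2 -(addrA (T l)) opprD (addrA (T z)).
  by rewrite [RHS]addrA [RHS]addrC subrK.
have modX : modulus (h ^+ 2) = modulus h ^+ 2 by rewrite !expr2 modulusM.
have mod2 : modulus (2^-1 : C) = 2^-1.
  rewrite /modulus Normc.normcV; congr _^-1; apply: (@complexI R).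
  by apply: (etrans (normr_nat C 2)); rewrite rmorph_nat.
have -> : norm2 ((T l - T z) *m x) = norm2 ((T z - T l) *m x).
  rewrite -opprB mulNmx -scaleN1r norm2Z.
  have -> : modulus (-1 : C) = 1 by apply: (@complexI R); exact: normrN1.
  by rewrite mul1r.
rewrite TE mulmxDl -!scalemxAl mulmxDl -scalemxAl.
apply: (le_trans (norm2_triangle _ _)); rewrite !norm2Z modX mulrDl.
have h0 := modulus_ge0 h.
apply: lerD.
  by rewrite [mxnorm2 _ * _]mulrC -mulrA ler_wpM2l// norm2_mulmx_mxnorm2.
rewrite [_ * modulus h ^+ 2]mulrC -[leRHS]mulrA ler_wpM2l ?sqr_ge0//.
apply: (le_trans (norm2_triangle _ _)); rewrite norm2Z mod2 mulrDl; apply: lerD.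
  by rewrite [_ / 2]mulrC -mulrA ler_wpM2l ?invr_ge0// norm2_mulmx_mxnorm2.
apply: (le_trans (norm2_mulmx_mxnorm2 _ _)).
by rewrite ler_wpM2r ?norm2_ge0.
Qed.

(** Turns minimization over [WW] into minimization over coordinate vectors, whose norm [W]
    preserves. *)
Lemma mem_orthonormal_basis_mx n m (WW : {vspace 'cV[C]_n}) (W : 'M[C]_(n, m))
    (x : 'cV[C]_n) :
  orthonormal_basis_mx WW W -> x \in WW <-> exists y, x = W *m y.
Proof.
move=> [_ <-]; split=> [xW|[y ->]].
  pose f := linfun (mulmx W : 'cV[C]_m -> 'cV[C]_n).
  have : (<<[seq col j W | j : 'I_m]>> <= limg f)%VS.
    apply/span_subvP => _ /mapP[j _ ->].
    by rewrite colE -[W *m _](lfunE (mulmx W)) memv_img// memvf.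
  by move=> /subvP/(_ _ xW)/memv_imgP[y _ ->]; exists y; rewrite lfunE.
have -> : W *m y = \sum_j y j 0 *: col j W.
  apply/colP => i; rewrite mxE summxE; apply: eq_bigr => j _.
  by rewrite !mxE mulrC.
apply: memv_suml => j _; apply: memvZ; apply: memv_span.
by apply/mapP; exists j; rewrite ?mem_enum.
Qed.

End SingularValues.

Theorem theorem4p3 (R : realType) (n m : nat) (Omega : set (Cplx R))
    (T : Cplx R -> 'M[Cplx R]_n) (lambda mu : Cplx R)
    (WW : {vspace 'cV[Cplx R]_n}) (W : 'M[Cplx R]_(n, m)) (r eta : R) :
  (1 < n)%N ->
  open Omega -> connected Omega ->
  analytic_on Omega T -> regular_on Omega T ->
  simple_eigenvalue_in Omega T lambda ->
  \dim WW = m -> orthonormal_basis_mx WW W ->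
  eigenvalue_in Omega (projected W T) mu ->
  0 < r -> 0 < eta ->
  closed_disc lambda r `<=` Omega ->
  (forall z, closed_disc lambda r z ->
     mxnorm2 (taylor2_remainder T lambda z) <= eta) ->
  closed_disc lambda r mu ->
  let gamma := mxnorm2 (derive1n 2 T lambda) / 2 + eta in
  sigma 1 (T mu *m W) <
    2^-1 * sigma 2 (T lambda)
    - mxnorm2 (derive1 T lambda) * modulus (mu - lambda) ->
  2 * gamma * modulus (mu - lambda) ^+ 2 < sigma 2 (T lambda) ->
  count_mem (sigma 1 (T mu *m W)) (singular_values (T mu *m W)) = 1%N /\
  exists2 x, refined_ritz_vector WW T mu x &
    forall x', refined_ritz_vector WW T mu x' ->
      exists2 c : Cplx R, modulus c = 1 & x' = c *: x.
Proof.
move=> n1 _ _ _ _ _ _ WWW [_ detB] _ _ _ rem_eta mu_disc gamma gap1 gap2.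
have W1 := WWW.1; set B := T mu *m W in gap1 *.
have BE z : B *m z = T mu *m (W *m z) by rewrite mulmxA.
(* The determinant of an empty matrix is 1, so [detB] excludes [m = 0]. *)
have m0 : (0 < m)%N.
  rewrite lt0n; apply/eqP => m0; subst m.
  by move/eqP: detB; rewrite det_mx00 oner_eq0.
have [j0 sj0] := sigma1_attained B m0.
have j0P j : gram_sv B j = sigma 1 B -> j = j0.
  move=> sj; apply: (sigma1_simple_perturbation n1 W1 _ _ sj sj0).
    by move=> x; exact: taylor2_perturbation (rem_eta _ mu_disc).
  (* Add [gap1] to half of [gap2]. *)
  by rewrite -/gamma -/B; lra.
split.
  rewrite count_singular_values; apply: (@fintype.eq_card1 _ j0) => j.
  by rewrite !inE; apply/eqP/eqP => [/j0P|->].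
(* The unit eigenvector for the least singular value; [W *m y0] will be the refined Ritz vector. *)
pose y0 : 'cV_m := ((gram_basis B)^t* *m delta_mx j0 0)%sesqui.
have Py0 : gram_basis B *m y0 = delta_mx j0 0.
  by rewrite mulmxA gram_basisVK mul1mx.
have y0_unit : norm2 y0 = 1.
  apply/eqP; rewrite -(@eqrXn2 _ 2) ?norm2_ge0// -(norm2_gram_basis B) Py0.
  rewrite norm2_sqr (bigD1 j0)//= big1 => [|j jj0].
    by rewrite mxE !eqxx modulus1 !expr1n addr0.
  by rewrite mxE (negbTE jj0) modulus0 expr0n.
have By0 : norm2 (B *m y0) <= sigma 1 B.
  rewrite -[leRHS]mulr1 -y0_unit; apply: norm2_mulmx_le (sigma1_ge0 _) _ => j.
  rewrite Py0 mxE; case: (eqVneq j j0) => [-> _|_]; first by rewrite sj0.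
  by rewrite /= eqxx.
exists (W *m y0).
  split; first by apply/(mem_orthonormal_basis_mx _ WWW); exists y0.
    by rewrite norm2_isometry.
  move=> v /(mem_orthonormal_basis_mx _ WWW)[y ->]; rewrite norm2_isometry// => y1.
  rewrite -!BE (le_trans By0)// -[leLHS]mulr1 -y1.
  by apply: norm2_mulmx_ge => j _; exact: sigma1_le.
move=> _ [/(mem_orthonormal_basis_mx _ WWW)[y ->] + ymin].
rewrite norm2_isometry// => y1.
(* Any minimizer does at least as well as the competitor [W *m y0]. *)
have By : norm2 (B *m y) <= sigma 1 B * norm2 y.
  rewrite y1 mulr1 (le_trans _ By0)// !BE; apply: ymin; last by rewrite norm2_isometry.
  by apply/(mem_orthonormal_basis_mx _ WWW); exists y0.
have yE := norm2_mulmx_le_sigma1 j0P By.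
(* The phase is the only nonzero eigenbasis coordinate of [y]; it has modulus 1 because [y] and [y0]
   are unit vectors. *)
exists ((gram_basis B *m y) j0 0); last by rewrite scalemxAr -yE.
by move: y1; rewrite {1}yE norm2Z y0_unit mulr1.
Qed.
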